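(* Let $\{X_k : k \geq 1\}$ be independent random variables, each uniformly distributed in $(0,1)$, and let $$\Omega_{\text{rand},\text{lin}} := \left\{ \frac{\pi X_k}{k} : k \geq 1\right\}.$$ Then the Perron's capacity of $\Omega_{\text{rand},\text{lin}}$ is finite almost surely, i.e. almost surely $$P(\Omega_{\text{rand},\text{lin}}) < \infty.$$
   Context: For a set of directions $\Omega \subset (0,\pi)$ (directions are identified with angles), let $\Omega^{-1} := \{ \pi/u : u \in \Omega\}$. For a finite set of real numbers $U = \{u_1 < u_2 < \dots < u_{2^N}\}$ of cardinality $2^N$, define its Perron's factor $$G(U) := \sup_{\substack{k,l \geq 1\\ k+2l \leq 2^N}} \left( \frac{u_{k+2l} - u_{k+l}}{u_{k+l} - u_{k}} + \frac{u_{k+l} - u_{k}}{u_{k+2l} - u_{k+l}} \right),$$ with $k,l$ integers. The Perron's capacity of $\Omega$ is $$P(\Omega) := \liminf_{N \to \infty} \ \inf_{\substack{U \subset \Omega^{-1}\\ \#U = 2^N}} G(U) \in [2,\infty].$$ *)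

(* Defs.v *)
From HB Require Import structures.
From mathcomp Require Import all_boot all_order all_algebra finmap.
From mathcomp Require Import all_classical all_reals all_analysis.

Set Implicit Arguments.
Unset Strict Implicit.
Unset Printing Implicit Defensive.

Import Order.TTheory GRing.Theory Num.Theory.
Import numFieldNormedType.Exports.

Local Open Scope classical_set_scope.
Local Open Scope ring_scope.

(* The indices i are one-based, as in U = {u_1 < u_2 < ...}. *)
Definition fset_elt (R : realType) (U : {fset R}) (i : nat) : R :=
  nth 0 (sort <=%R (enum_fset U)) i.-1.

(* The elements of U are distinct, so no denominator below vanishes; when U has
   fewer than three elements there is no admissible (k, l) and the value is the
   supremum -oo of the empty set. *)
Definition perron_factor (R : realType) (U : {fset R}) : \bar R :=
  let u := fset_elt U in
  ereal_sup [set g : \bar R | exists k l : nat,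
    [/\ (1 <= k)%N, (1 <= l)%N, (k + 2 * l <= #|` U|)%N &
      g = ((u (k + 2 * l)%N - u (k + l)%N) / (u (k + l)%N - u k) +
           (u (k + l)%N - u k) / (u (k + 2 * l)%N - u (k + l)%N))%:E]].

Definition inv_directions (R : realType) (Omega : set R) : set R :=
  [set pi / u | u in Omega].

(* The infimum over an empty family of sets U is +oo. *)
Definition perron_capacity (R : realType) (Omega : set R) : \bar R :=
  limn_einf (fun N : nat => ereal_inf
    [set perron_factor U | U in [set U : {fset R} |
      [set` U] `<=` inv_directions Omega /\ #|` U| = (2 ^ N)%N]]).

Definition mutually_independent (d d' : measure_display)
    (T : measurableType d) (T' : measurableType d') (R : realType)
    (P : probability T R) (I : choiceType) (D : set I)
    (X : I -> {RV P >-> T'}) : Prop :=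
  forall (J : {fset I}) (A : I -> set T'),
    [set` J] `<=` D -> (forall i, i \in J -> measurable (A i)) ->
    P (\bigcap_(i in [set` J]) (X i @^-1` A i)) =
      (\prod_(i <- J) P (X i @^-1` A i))%E.

Definition uniform01 (d : measure_display) (T : measurableType d)
    (R : realType) (P : probability T R) (X : {RV P >-> R}) : Prop :=
  forall A : set R, measurable A ->
    distribution P X A = uniform_prob (@ltr01 R) A.

Definition Omega_rand_lin (R : realType) (T : Type) (X : nat -> T -> R)
    (t : T) : set R :=
  [set pi * X k t / k%:R | k in [set k : nat | (1 <= k)%N]].

(* Main.v *)
Require Import Defs.
From HB Require Import structures.
From mathcomp Require Import all_boot all_order all_algebra finmap.
From mathcomp Require Import all_classical all_reals all_analysis.
From mathcomp Require Import zify ring lra.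

Local Open Scope classical_set_scope.
Local Open Scope ring_scope.

Import Order.TTheory GRing.Theory Num.Theory.
Import numFieldNormedType.Exports.

(** Since pi / (pi X_k / k) = k / X_k, the capacity concerns finite sets of points
    k / X_k, and Perron's factor is invariant under affine maps of the line. A
    set that follows an arithmetic progression up to an error of half its step
    has Perron's factor at most 6 ([perron_factor_progression]), whatever its
    cardinality m. It therefore suffices to find almost surely, for each
    m = 2 ^ N, such a set among the k / X_k.

    The step of the progression may be as large as the indices k. If k = K + j + 1
    with j < m and X_k lies in [1 / (4 j + 5), 1 / (4 j + 4)], then k / X_k
    lies in k [4 j + 4, 4 j + 5], which is contained in K [4 j + 4, 4 j + 6] once
    K >= m (4 m + 1), because k / K is then close to 1. So if these m conditions
    hold together, the m points k / X_k are an approximate progression of step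
    4 K ([block_event_perron]). The probability that they hold together is the
    product over j < m of 1 / (4 j + 4) - 1 / (4 j + 5); it is positive and does
    not depend on K ([block_event_prob]). Disjoint blocks of m consecutive
    indices give independent events of this same probability, so almost surely
    one of them occurs ([ae_some_event]). Intersecting over the countably many N
    shows that the capacity is at most 6 almost surely. *)

Lemma sorted_fset_elt {R : realType} {s : seq R} {U : {fset R}} (i : nat) :
  sorted <%R s -> U =i s -> fset_elt U i = s`_i.-1.
Proof.
move=> s_lt Us; rewrite /fset_elt; congr nth.
apply: (sorted_eq le_trans le_anti) => //.
- by apply: sort_sorted; exact: le_total.
- by apply: sub_sorted s_lt => x y; exact: ltW.
- rewrite perm_sort; apply: uniq_perm => //; first exact: fset_uniq.
  exact: lt_sorted_uniq.
Qed.

Lemma ratio_sum_le {R : realFieldType} {x y : R} :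
  0 < x -> 0 < y -> x <= 3 * y -> y <= 3 * x -> x / y + y / x <= 6.
Proof.
move=> x0 y0 xy yx.
have h1 : x / y <= 3 by rewrite ler_pdivrMr.
have h2 : y / x <= 3 by rewrite ler_pdivrMr.
lra.
Qed.

(** The hypothesis places the i-th point within half a step of b + 4 c i. A
    difference over l >= 1 indices then lies between c (4 l - 2) and c (4 l + 2),
    so two such differences have a ratio at most 3, and the two ratios in
    Perron's factor add up to at most 6. *)
Lemma perron_factor_progression {R : realType} {m : nat} {b c : R} {v : nat -> R}
    {U : {fset R}} :
  0 < c -> (forall i, (i < m)%N -> c * (4 * i)%:R <= v i - b <= c * (4 * i + 2)%:R) ->
  U =i mkseq v m -> #|` U| = m /\ (perron_factor U <= 6%:E)%E.
Proof.
move=> c0 hv Us.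
have gap i l : (0 < l)%N -> (i + l < m)%N ->
    c * (4 * l - 2)%:R <= v (i + l)%N - v i <= c * (4 * l + 2)%:R.
  move=> l0 ilm.
  have /andP[a1 a2] := hv i (leq_ltn_trans (leq_addr _ _) ilm).
  have /andP[b1 b2] := hv _ ilm.
  have -> : c * (4 * l - 2)%:R = c * (4 * (i + l))%:R - c * (4 * i + 2)%:R.
    rewrite -mulrBr -natrB; last lia.
    by congr (_ * _%:R); lia.
  have -> : c * (4 * l + 2)%:R = c * (4 * (i + l) + 2)%:R - c * (4 * i)%:R.
    rewrite -mulrBr -natrB; last lia.
    by congr (_ * _%:R); lia.
  by apply/andP; split; lra.
have v_lt : sorted <%R (mkseq v m).
  apply/(sortedP 0) => i; rewrite size_mkseq => im.
  rewrite !nth_mkseq//; last exact: ltnW.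
  rewrite -subr_gt0 -addn1.
  have /andP[+ _] := @gap i 1%N isT ltac:(by rewrite addn1).
  by apply: lt_le_trans; rewrite mulr_gt0.
have Um : #|` U| = m.
  rewrite -(size_mkseq v m); apply: (@perm_size _ (enum_fset U)).
  apply: uniq_perm => //.
  exact: lt_sorted_uniq.
split => //; apply: ge_ereal_sup => _ [k [l [k1 l1 klm ->]]].
rewrite Um in klm; rewrite !(sorted_fset_elt _ v_lt Us) !nth_mkseq; try lia.
have /andP[x1 x2] := @gap k.-1 l l1 ltac:(lia).
have /andP[y1 y2] := @gap (k.-1 + l)%N l l1 ltac:(lia).
have -> : (k + 2 * l).-1 = (k.-1 + l + l)%N by lia.
have -> : (k + l).-1 = (k.-1 + l)%N by lia.
have lo : 0 < c * (4 * l - 2)%:R by rewrite mulr_gt0// ltr0n; lia.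
(* 4 l + 2 <= 3 (4 l - 2) as soon as l >= 1 *)
have hilo : c * (4 * l + 2)%:R <= 3 * (c * (4 * l - 2)%:R).
  by rewrite mulrCA ler_pM2l// -natrM ler_nat; lia.
rewrite lee_fin; apply: ratio_sum_le; lra.
Qed.

Lemma uniform01_itv {d : measure_display} {T : measurableType d}
    {R : realType} {P : probability T R} {X : {RV P >-> R}} {a b : R} :
  uniform01 X -> 0 <= a -> a <= b -> b <= 1 ->
  P (X @^-1` `[a, b]) = (b - a)%:E.
Proof.
move=> Xunif a0 ab b1.
have := Xunif `[a, b]%classic (measurable_itv `[a, b]); rewrite /distribution/= /pushforward => ->.
rewrite /uniform_prob.
under eq_integral => x.
  rewrite inE/= in_itv/= => /andP[ax xb].
  rewrite /uniform_pdf (le_trans a0 ax) (le_trans xb b1) /= subr0 invr1.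
  over.
rewrite integral_cst//= mul1e lebesgue_measure_itv/= lte_fin.
by case: ltgtP ab => // -> _; rewrite subrr.
Qed.

(** The half of the Borel-Cantelli lemma that uses independence, for events of
    equal probability. Independence is assumed for the events only; it passes
    to their complements by removing the events E 0, E 1, and so on one at a time
    from an intersection of events of larger index, each removal multiplying the
    probability by 1 - p. None of E 0, ..., E (n - 1) occurs with probability
    (1 - p) ^ n, which tends to 0. *)
Lemma ae_some_event {d : measure_display} {T : measurableType d}
    {R : realType} {P : probability T R} {E : nat -> set T} {p : R} :
  0 < p -> (forall n, measurable (E n)) ->
  (forall J : {fset nat}, P (\bigcap_(n in [set` J]) E n) = (p ^+ #|` J|)%:E) ->
  {ae P, forall t, exists n, E n t}.
Proof.
move=> p0 mE PE.
have mJ (J : {fset nat}) : measurable (\bigcap_(n in [set` J]) E n).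
  by apply: fin_bigcap_measurable => // i _; exact: mE.
have mC n : measurable (\bigcap_(i in `I_n) ~` E i).
  by apply: fin_bigcap_measurable => // i _; exact: measurableC.
have p1 : p <= 1.
  have := probability_le1 P (mJ [fset 0%N]%fset).
  by rewrite PE cardfs1 lee_fin.
have step n : forall J : {fset nat}, (forall j, j \in J -> (n <= j)%N) ->
    P ((\bigcap_(i in `I_n) ~` E i) `&` \bigcap_(i in [set` J]) E i) =
    ((1 - p) ^+ n * p ^+ #|` J|)%:E.
  elim: n => [J _|n IH J nJ].
    by rewrite II0 bigcap_set0 setTI PE mul1r.
  have nnJ : n \notin J by apply/negP => /nJ; rewrite ltnn.
  have -> : (\bigcap_(i in `I_n.+1) ~` E i) `&` \bigcap_(i in [set` J]) E i =
      ((\bigcap_(i in `I_n) ~` E i) `&` \bigcap_(i in [set` J]) E i) `\` E n.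
    by rewrite IIS bigcap_setU bigcap_set1 -setIA [~` _ `&` _]setIC setIA setDE.
  set C := _ `&` _; have mCJ : measurable C by exact: measurableI.
  have -> : P (C `\` E n) = (P C - P (C `&` E n))%E.
    by apply: measureD => //; rewrite ltey_eq fin_num_measure.
  rewrite /C.
  rewrite -setIA [_ `&` E n]setIC -bigcap_setU1 -set_fsetU1.
  rewrite !IH; first last.
  - by move=> j /nJ /ltnW.
  - by move=> j; rewrite in_fset1U => /orP[/eqP->//|/nJ /ltnW].
  by rewrite cardfsU1 nnJ -EFinB add1n !exprS; congr EFin; ring.
exists (\bigcap_n ~` E n); split.
- by apply: bigcap_measurableType => i _; exact: measurableC.
- apply/eqP; rewrite eq_le measure_ge0 andbT -[leRHS]/(0%:E).
  have le_n n : (P (\bigcap_i ~` E i) <= ((1 - p) ^+ n)%:E)%E.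
    have := step n fset0 ltac:(by []).
    rewrite cardfs0 mulr1 set_fset0 bigcap_set0 setIT => <-.
    apply: le_measure; rewrite ?inE//.
      by apply: bigcap_measurableType => i _; exact: measurableC.
    by move=> t ht i _; exact: ht.
  apply: (@cvge_ge _ \oo _ _ (fun n => ((1 - p) ^+ n)%:E)).
  + by apply: nearW.
  + apply: cvg_EFin; first exact: nearW.
    apply: cvg_expr; rewrite ger0_norm; lra.
- by move=> t /= h n _ Ent; apply: h; exists n.
Qed.

(** The blocks n = 0, 1, ... are consecutive and disjoint, and the offset
    m (4 m + 1) makes every index of a block comparable to its starting point:
    they differ by a factor of at most 1 + 1 / (4 m + 1). *)
Definition block_index (m n j : nat) : nat := (m * (4 * m + 1 + n) + j).+1.

Definition slot (R : realType) (j : nat) : set R :=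
  `[(4 * j + 5)%:R^-1, (4 * j + 4)%:R^-1].

Definition block_event {R : realType} {d : measure_display}
    {T : measurableType d} {P : probability T R} (X : nat -> {RV P >-> R})
    (m n : nat) : set T :=
  \bigcap_(j in `I_m) X (block_index m n j) @^-1` slot R j.

(** An intersection of block events is a condition on finitely many distinct
    X_k, each asked to lie in the slot given by the position of k in its block;
    independence of the X_k then turns its probability into a double product. *)
Lemma block_event_prob {R : realType} {d : measure_display}
    {T : measurableType d} {P : probability T R} (X : nat -> {RV P >-> R})
    (X_indep : mutually_independent [set k : nat | (1 <= k)%N] X)
    (X_unif : forall k : nat, (1 <= k)%N -> uniform01 (X k))
    (m : nat) (J : {fset nat}) :
  P (\bigcap_(n in [set` J]) block_event X m n) =
  ((\prod_(0 <= j < m) ((4 * j + 4)%:R^-1 - (4 * j + 5)%:R^-1)) ^+ #|` J|)%:E.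
Proof.
pose js := index_iota 0 m.
pose s := [seq block_index m n j | n <- enum_fset J, j <- js].
(* k.-1 %% m is the position j of k = block_index m n j in its block. *)
pose A k := slot R (k.-1 %% m).
have Ablock n j : (j < m)%N -> A (block_index m n j) = slot R j.
  by move=> jm; rewrite /A /= mulnC modnMDl modn_small.
have us : uniq s.
  apply: allpairs_uniq; [exact: fset_uniq | exact: iota_uniq |].
  move=> [n j] [n' j'] /allpairsP[[a b] /= [_ bm [-> ->]]].
  move=> /allpairsP[[a' b'] /= [_ bm' [-> ->]]] /= [].
  rewrite !mem_index_iota /= in bm bm'.
  move=> e; have m0 : (0 < m)%N by lia.
  have := congr1 (modn^~ m) e; rewrite /= ![(m * _)%N]mulnC !modnMDl !modn_small// => bb.
  move: e; rewrite bb => /addIn /eqP; rewrite eqn_pmul2l// => /eqP.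
  by move/addnI => ->.
pose K : {fset nat} := seq_fset tt s.
have KE : K =i s by exact: seq_fsetE.
have -> : \bigcap_(n in [set` J]) block_event X m n =
    \bigcap_(k in [set` K]) X k @^-1` A k.
  apply/seteqP; split=> t h.
  - move=> k /=; rewrite KE => /allpairsP[[n j] /= [nJ]].
    rewrite mem_index_iota /= => jm ->; rewrite /preimage /= Ablock//.
    exact: (h n nJ j jm).
  - move=> n nJ j jm; rewrite /preimage /= -(Ablock n)//; apply: h => /=.
    rewrite KE; apply/allpairsP; exists (n, j) => /=.
    by rewrite mem_index_iota.
rewrite X_indep; last 2 first.
- by move=> k /=; rewrite KE => /allpairsP[[n j] /= [_ _ ->]].
- by move=> k _; exact: measurable_itv.
rewrite (perm_big _ (seq_fset_perm tt s)) /= undup_id//.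
rewrite big_allpairs_dep /=.
under eq_bigr => n _.
  rewrite big_seq.
  under eq_bigr => j.
    rewrite mem_index_iota /= => jm; rewrite Ablock// uniform01_itv//; first over.
    - by apply: X_unif.
    - by rewrite lef_pV2 ?posrE ?ltr0n ?ler_nat; lia.
    - by rewrite invf_le1 ?ler1n ?ltr0n; lia.
  rewrite -big_seq.
  over.
by rewrite prodEFin big_const_seq count_predT iter_mule mule1 EFin_expe.
Qed.

Lemma limn_einf_le {R : realType} {u : nat -> \bar R} {c : \bar R} :
  (forall n, (u n <= c)%E) -> (limn_einf u <= c)%E.
Proof.
move=> uc; rewrite limn_einf_lim; apply: lime_le; first exact: is_cvg_einfs.
apply: nearW => n; apply: (le_trans _ (uc n)).
by apply: ereal_inf_lbound; exists n => /=.
Qed.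

(** With c = m (4 m + 1 + n) the start of the block, the points k / X_k lie in
    4 c + c [4 j, 4 j + 2]: the slots bound them by k (4 j + 4) and k (4 j + 5),
    and k (4 j + 5) <= c (4 j + 6) because (j + 1) (4 j + 5) <= m (4 m + 1) <= c. *)
Lemma block_event_perron {R : realType} {T : Type} (X : nat -> T -> R) (t : T)
    (m n : nat) : (0 < m)%N ->
  (forall j, (j < m)%N -> slot R j (X (block_index m n j) t)) ->
  exists U : {fset R}, [/\ [set` U] `<=` inv_directions (Omega_rand_lin X t),
    #|` U| = m & (perron_factor U <= 6%:E)%E].
Proof.
move=> m0 Xt.
pose c : R := (m * (4 * m + 1 + n))%:R.
pose v j := (block_index m n j)%:R / X (block_index m n j) t.
have bnd j : (j < m)%N -> 0 < X (block_index m n j) t /\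
    c * (4 * j)%:R <= v j - 4 * c <= c * (4 * j + 2)%:R.
  move=> jm; have := Xt j jm; rewrite /slot /= in_itv /=.
  rewrite /v; set x := X _ _; set k := block_index m n j => /andP[lo hi].
  have x0 : 0 < x by apply: lt_le_trans lo; rewrite invr_gt0 ltr0n; lia.
  split=> //; rewrite lerBrDr lerBlDr -!(mulrC c) -!mulrDr -!natrD.
  have lo' : x^-1 <= (4 * j + 5)%:R.
    by rewrite -[leRHS]invrK lef_pV2 ?posrE ?invr_gt0 ?ltr0n//; lia.
  have hi' : (4 * j + 4)%:R <= x^-1.
    by rewrite -[leLHS]invrK lef_pV2 ?posrE ?invr_gt0 ?ltr0n//; lia.
  apply/andP; split.
  - apply: (@le_trans _ _ (k%:R * (4 * j + 4)%:R)); last by rewrite ler_wpM2l.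
    by rewrite -!natrM ler_nat leq_mul// /k /block_index; lia.
  - apply: (@le_trans _ _ (k%:R * (4 * j + 5)%:R)); first by rewrite ler_wpM2l.
    rewrite -!natrM ler_nat /k /block_index.
    nia.
pose U : {fset R} := seq_fset tt (mkseq v m).
have UE : U =i mkseq v m by exact: seq_fsetE.
have [] := @perron_factor_progression _ m (4 * c) c v U _ _ UE.
- by rewrite ltr0n; nia.
- by move=> j /bnd[].
move=> U_card U_le; exists U; split=> //.
move=> z /=; rewrite UE => /mapP[j]; rewrite mem_iota /= => jm ->.
have [x0 _] := bnd j jm.
exists (pi * X (block_index m n j) t / (block_index m n j)%:R).
  by exists (block_index m n j).
rewrite /v; move: (pi : R) (lt0r_neq0 (pi_gt0 R)) => q q0; field.
by rewrite lt0r_neq0// q0 pnatr_eq0.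
Qed.

Theorem theorem8 (R : realType) (d : measure_display) (T : measurableType d)
    (P : probability T R) (X : nat -> {RV P >-> R})
    (X_indep : mutually_independent [set k : nat | (1 <= k)%N] X)
    (X_unif : forall k : nat, (1 <= k)%N -> uniform01 (X k)) :
  {ae P, forall t, (perron_capacity (Omega_rand_lin X t) < +oo)%E}.
Proof.
have : {ae P, forall t, forall N, exists n, block_event X (2 ^ N) n t}.
  apply: ae_foralln => N.
  apply: (@ae_some_event _ _ _ _ _
    (\prod_(0 <= j < 2 ^ N) ((4 * j + 4)%:R^-1 - (4 * j + 5)%:R^-1))).
  - apply: prodr_gt0 => j _.
    by rewrite subr_gt0 ltf_pV2 ?posrE ?ltr0n ?ltr_nat; lia.
  - move=> n; apply: fin_bigcap_measurable => // j _.
    by rewrite -[_ @^-1` _]setTI; apply: measurable_funP => //; exact: measurable_itv.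
  - move=> J; exact: block_event_prob.
apply: filterS => t blocks.
apply: (@le_lt_trans _ _ 6%:E); last exact: ltry.
apply: limn_einf_le => N; have [n nt] := blocks N.
have [|U [U_sub U_card U_le]] := block_event_perron (fun k => X k) t (2 ^ N) n _ nt.
  by rewrite expn_gt0.
by apply: ge_ereal_inf; exists (perron_factor U) => //; exists U.
Qed.
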